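(* For every integer $n\ge 1$, the following identity of polynomials in $t$ holds: $$(2n)!\,\Omega(\mathcal{R}_{2,n};t)=\sum_{\sigma} t^{\widetilde{\mathrm{bl}}(\sigma)},$$ where the sum runs over all $(2n)!$ labelings $\sigma$ of the $2\times n$ rectangle poset $\mathcal{R}_{2,n}$ (bijections $\sigma:\mathcal{R}_{2,n}\to\{1,\dots,2n\}$), $\Omega(\mathcal{R}_{2,n};t)$ is the order polynomial of $\mathcal{R}_{2,n}$, and $\widetilde{\mathrm{bl}}(\sigma)$ is the number of blocks of $\sigma$.
   Context: Order polynomial: for a finite poset $P$, $\Omega(P;t)$ is the polynomial whose value at each positive integer $t$ is the number of (weakly) order-preserving maps $P\to\{1,\dots,t\}$. Poset: $\mathcal{R}_{2,n}$ has cells $(i,j)$ with $i\in\{1,2\}$ (row, $1$ = top, $2$ = bottom) and $j\in\{1,\dots,n\}$ (column), with covering relations $(1,j)\gtrdot(2,j)$ and $(i,j)\gtrdot(i,j+1)$ whenever both cells are present; $(1,1)$ is the unique maximum. A labeling is a bijection $\sigma:\mathcal{R}_{2,n}\to\{1,\dots,2n\}$; write $b_j=\sigma(2,j)$ (bottom row) and $a_j=\sigma(1,j)$ (top row), and refer to a cell also by its label. Block statistic: the blocks of $\sigma$ are built in two stages. (1) Bottom row. Scan $b_1,\dots,b_n$ from left to right. Start a block rooted at $b_1$; a block rooted at $b_r$ absorbs $b_{r+1},b_{r+2},\dots$ as long as the values exceed $b_r$, and the first value smaller than $b_r$ starts a new block rooted at it. So the block roots are exactly the left-to-right running minima of $(b_1,\dots,b_n)$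 (position $1$, and positions $j$ with $b_j<\min(b_1,\dots,b_{j-1})$). Let $L(\sigma)$ be the number of these blocks. (2) Top row. Insert $a_1,\dots,a_n$ from left to right. When inserting $a_j$, let $x_-$ be the root of the block containing $b_j$, and let $x_+$ be the root of the block containing $a_{j-1}$ (with $\sigma(x_+)=+\infty$ for $j=1$). One always has $\sigma(x_-)\le\sigma(x_+)$. The placement rule is: if $\sigma(x_-)=\sigma(x_+)$, then $a_j$ joins that shared block; if $\sigma(x_-)<a_j<\sigma(x_+)$, then $a_j$ starts a new block rooted at $a_j$; if $\sigma(x_-)<\sigma(x_+)<a_j$, then $a_j$ joins the block of $x_+$; if $\sigma(x_-)<\sigma(x_+)$ and $a_j<\sigma(x_-)$, then $a_j$ joins the block of $x_-$. A block keeps its root when a cell joins it. Let $N(\sigma)$ be the number of new blocks created in this stage. The number of blocks is $\widetilde{\mathrm{bl}}(\sigma)=L(\sigma)+N(\sigma)$. *)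

(* Defs.v *)
From HB Require Import structures.
From mathcomp Require Import all_boot all_order all_algebra.

Set Implicit Arguments.
Unset Strict Implicit.
Unset Printing Implicit Defensive.

Import Order.TTheory GRing.Theory Num.Theory.

Local Open Scope ring_scope.

(* The chain {1, ..., t} is rendered as 'I_t = {0, ..., t-1}. *)
Definition order_preserving d (P : finPOrderType d) t (f : {ffun P -> 'I_t}) :
    bool :=
  [forall x, forall y, (x <= y)%O ==> (f x <= f y)%N].

Definition is_order_poly d (P : finPOrderType d) (p : {poly rat}) : Prop :=
  forall t : nat, (0 < t)%N ->
    p.[t%:R] = #|[set f : {ffun P -> 'I_t} | order_preserving f]|%:R.

Lemma is_order_poly_unique d (P : finPOrderType d) (p q : {poly rat}) :
  is_order_poly P p -> is_order_poly P q -> p = q.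
Proof.
move=> hp hq; apply/eqP; rewrite -subr_eq0; apply/negPn/negP => nz.
pose s := [seq (i.+1)%:R : rat | i <- iota 0 (size (p - q))].
have sr : all (root (p - q)) s.
  apply/allP=> _ /mapP[i _ ->].
  by rewrite rootE hornerD hornerN hp // hq // subrr.
have su : uniq s.
  rewrite map_inj_uniq ?iota_uniq // => i j /eqP.
  by rewrite eqr_nat => /eqP[].
by have := max_poly_roots nz sr su; rewrite size_map size_iota ltnn.
Qed.

Definition bin_poly (k : nat) : {poly rat} :=
  (k`!%:R)^-1 *: \prod_(i < k) ('X - (i%:R)%:P).

Lemma bin_polyE (k t : nat) : (bin_poly k).[t%:R] = 'C(t, k)%:R.
Proof.
have E : (\prod_(i < k) ('X - (i%:R)%:P) : {poly rat}).[t%:R] = (t ^_ k)%:R.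
  elim: k => [|k IH]; first by rewrite big_ord0 hornerC.
  rewrite big_ord_recr /= hornerM IH !hornerE ffactnSr natrM.
  case: (leqP k t) => h; first by rewrite natrB.
  by rewrite ffact_small // !mul0r.
rewrite /bin_poly hornerZ E -bin_ffact natrM mulrC mulfK //.
by rewrite pnatr_eq0 -lt0n fact_gt0.
Qed.

Section Existence.
Variables (d : Order.disp_t) (P : finPOrderType d).

Let onto k :=
  #|[set g : {ffun P -> 'I_k} | order_preserving g & g @: [set: P] == setT]|.

Let card_im t (A : {set 'I_t}) :
  #|[set f : {ffun P -> 'I_t} | order_preserving f & f @: [set: P] == A]|
    = onto #|A|.
Proof.
pose h (g : {ffun P -> 'I_#|A|}) : {ffun P -> 'I_t} :=
  [ffun x => Order.enum_val (g x)].
have hinj : injective h.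
  move=> g1 g2 /ffunP e; apply/ffunP=> x.
  by have := e x; rewrite !ffunE => /Order.enum_val_inj.
have mono (i j : 'I_#|A|) :
    ((Order.enum_val i : 'I_t) <= (Order.enum_val j : 'I_t))%N = (i <= j)%N.
  by have := @Order.le_enum_val _ 'I_t (@Order.TotalTheory.le_total _ _) A i j;
    rewrite !leEord.
rewrite /onto -(card_imset _ hinj); apply: eq_card => f; rewrite inE.
apply/andP/imsetP=> [[/forallP fo /eqP fA]|[g]].
- have inA x : f x \in A by rewrite -fA imset_f.
  exists [ffun x => Order.enum_rank_in (inA x) (f x)].
    rewrite inE; apply/andP; split.
      apply/forallP=> x; apply/forallP=> y; apply/implyP=> xy.
      rewrite !ffunE -mono !Order.enum_rankK_in //.
      by move/forallP: (fo x) => /(_ y) /implyP; apply.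
    rewrite eqEsubset subsetT; apply/subsetP=> i _.
    have := Order.enum_valP i; rewrite -{2}fA => /imsetP[x _ ex].
    apply/imsetP; exists x => //; rewrite ffunE; apply: Order.enum_val_inj.
    by rewrite Order.enum_rankK_in.
  by apply/ffunP=> x; rewrite !ffunE Order.enum_rankK_in.
- rewrite inE => /andP[/forallP go /eqP gT] ->; split.
    apply/forallP=> x; apply/forallP=> y; apply/implyP=> xy.
    by rewrite !ffunE mono; move/forallP: (go x) => /(_ y) /implyP; apply.
  rewrite eqEsubset; apply/andP; split; apply/subsetP=> i.
    by case/imsetP=> x _ ->; rewrite ffunE; apply: Order.enum_valP.
  move=> iA; have : Order.enum_rank_in iA i \in g @: [set: P].
    by rewrite gT in_setT.
  case/imsetP=> x _ ex; apply/imsetP; exists x => //.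
  by rewrite ffunE -ex Order.enum_rankK_in.
Qed.

Lemma order_poly_exists : {p : {poly rat} | is_order_poly P p}.
Proof.
exists (\sum_(k < #|P|.+1) (onto k)%:R *: bin_poly k) => t _.
rewrite horner_sum.
under eq_bigr => k _ do rewrite hornerZ bin_polyE -natrM.
rewrite -natr_sum; congr (_%:R).
pose im (f : {ffun P -> 'I_t}) : 'I_#|P|.+1 := inord #|f @: [set: P]|.
have imE (f : {ffun P -> 'I_t}) : im f = #|f @: [set: P]| :> nat.
  by rewrite inordK // ltnS (leq_trans (leq_imset_card _ _)) // cardsT.
rewrite -[RHS]sum1dep_card (partition_big im predT) //=.
apply: eq_bigr => k _.
rewrite (partition_big (fun f : {ffun P -> 'I_t} => f @: [set: P])
  (fun A => #|A| == k)) /=; last first.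
  by move=> f /andP[_ /eqP <-]; rewrite imE.
transitivity (\sum_(A : {set 'I_t} | #|A| == k) onto k)%N.
  rewrite sum_nat_const mulnC; congr (_ * _)%N.
  by rewrite -{1}(card_ord t) -card_draws cardsE.
apply: eq_bigr => A /eqP Ak.
rewrite -Ak -card_im -sum1dep_card; apply: eq_bigl => f.
case: (@eqP _ (_ @: _) A) => [e|_]; last by rewrite !andbF.
by rewrite !andbT -val_eqE /= imE e Ak eqxx andbT.
Qed.

End Existence.

Definition order_poly d (P : finPOrderType d) : {poly rat} :=
  sval (order_poly_exists P).

Lemma order_polyP d (P : finPOrderType d) : is_order_poly P (order_poly P).
Proof. exact: (svalP (order_poly_exists P)). Qed.

(* Rows and columns are numbered from 0: the cell (i, j) of the text is
   (i - 1, j - 1) here, so that row 0 is the top row and row 1 the bottom. *)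
Definition rect (n : nat) : Type := ('I_2 * 'I_n)%type.

HB.instance Definition _ n := Finite.on (rect n).

Section RectOrder.
Variable n : nat.
Implicit Types x y z : rect n.

Definition top_cell (j : 'I_n) : rect n := (ord0, j).
Definition bot_cell (j : 'I_n) : rect n := (ord_max, j).

(* [covered x y] means that y covers x. *)
Definition covered x y : bool :=
  [exists j, (x == bot_cell j) && (y == top_cell j)]
  || ((x.1 == y.1) && (x.2 == y.2.+1 :> nat)).

Definition rect_le : rel (rect n) := connect covered.

Lemma covered_ge x y :
  covered x y -> (y.1 <= x.1)%N && (y.2 <= x.2)%N.
Proof.
case/orP=> [/existsP[j /andP[/eqP-> /eqP->]]|/andP[/eqP-> /eqP->]] /=.
  by rewrite leqnn.
by rewrite leqnn leqnSn.
Qed.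

Lemma rect_le_ge x y : rect_le x y -> (y.1 <= x.1)%N && (y.2 <= x.2)%N.
Proof.
case/connectP=> p; elim: p x => [|z p IH] x /=; first by move=> _ ->; rewrite !leqnn.
case/andP=> /covered_ge/andP[h1 h2] pz /(IH _ pz)/andP[h3 h4].
by rewrite (leq_trans h3 h1) (leq_trans h4 h2).
Qed.

Lemma rect_le_refl : reflexive rect_le.
Proof. exact: connect0. Qed.

Lemma rect_le_anti : antisymmetric rect_le.
Proof.
move=> [i j] [k l] /andP[/rect_le_ge/andP[/= h1 h2] /rect_le_ge/andP[/= h3 h4]].
by congr (_, _); apply/val_inj/eqP; rewrite eqn_leq ?h1 ?h2 ?h3 ?h4.
Qed.

Lemma rect_le_trans : transitive rect_le.
Proof. by move=> y x z; apply: connect_trans. Qed.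

End RectOrder.

Fact rect_display : Order.disp_t. Proof. exact: Order.Disp tt tt. Qed.

HB.instance Definition _ n := Order.Le_isPOrder.Build rect_display (rect n)
  (@rect_le_refl n) (@rect_le_anti n) (@rect_le_trans n).

Lemma rect_leE n (x y : rect n) :
  (x <= y)%O = (y.1 <= x.1)%N && (y.2 <= x.2)%N.
Proof.
rewrite -[LHS]/(rect_le x y).
apply/idP/idP => [/rect_le_ge//|].
have horiz (i : 'I_2) (k j : 'I_n) : (j <= k)%N -> rect_le (i, k) (i, j).
  case: k j => k hk j /= h; rewrite -(subnK h) in hk *.
  elim: (k - j)%N hk => [|m IH] hk.
    by rewrite (_ : Ordinal hk = j) ?rect_le_refl //; apply: val_inj.
  have hk' : (m + j < n)%N by apply: ltnW.
  apply: rect_le_trans (IH hk'); apply: connect1.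
  by rewrite /covered /= !eqxx orbT.
case: x y => [i k] [i' j] /= /andP[hi hj].
apply: rect_le_trans (horiz i k j hj) _.
have [<-|ne] := eqVneq i i'; first exact: rect_le_refl.
apply: connect1; apply/orP; left; apply/existsP; exists j.
have {}hi : (i' < i)%N by rewrite ltn_neqAle hi andbT eq_sym.
have e1 : i = ord_max.
  by apply: val_inj => /=; case: i hi {ne} => [[|[|m]] hm].
have e0 : i' = ord0.
  by apply: val_inj => /=; case: i' hi {ne} => [[|[|m]] hm] //=; rewrite e1.
by rewrite /bot_cell /top_cell e1 e0 !eqxx.
Qed.

(* The bijection onto {1, ..., 2n} is [label s] below; [s] is shifted by one. *)
Notation labeling n := {ffun rect n -> 'I_(2 * n)}.

Definition is_labeling n (s : labeling n) : bool :=
  injectiveb s && [forall k, k \in codom s].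

Lemma is_labelingP n (s : labeling n) : reflect (bijective s) (is_labeling s).
Proof.
apply: (iffP andP) => [[/injectiveP si _]|sb].
  by apply: inj_card_bij => //; rewrite card_prod !card_ord.
split; first by apply/injectiveP/bij_inj.
by case: sb => g _ gK; apply/forallP=> k; rewrite -(gK k) codom_f.
Qed.

Lemma card_labelings n : #|[set s : labeling n | is_labeling s]| = (2 * n)`!.
Proof.
have -> : [set s : labeling n | is_labeling s]
        = [set s : {ffun rect n -> 'I_(2 * n)} | injectiveb s].
  apply/setP=> s; rewrite !inE; apply/is_labelingP/injectiveP.
    exact: bij_inj.
  by move=> si; apply: inj_card_bij => //; rewrite card_prod !card_ord.
by rewrite card_inj_ffuns card_prod !card_ord ffactnn.
Qed.

Definition label n (s : labeling n) (x : rect n) : nat := (s x).+1.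

Definition top_labels n (s : labeling n) : seq nat :=
  [seq label s (top_cell j) | j <- enum 'I_n].

Definition bot_labels n (s : labeling n) : seq nat :=
  [seq label s (bot_cell j) | j <- enum 'I_n].

(* A block is represented by the label of its root. For every position j,
   [bottom_roots] gives the root of the block containing b_j. *)
Definition bottom_step (r b : nat) : nat := if (r < b)%N then r else b.

Definition bottom_roots (b : seq nat) : seq nat :=
  if b is b1 :: b' then b1 :: scanl bottom_step b1 b' else [::].

Definition nb_bottom_blocks (b : seq nat) : nat := size (undup (bottom_roots b)).

(* [place xm xp a] is the root of the block in which the cell labeled [a] is
   placed, paired with whether this block is new; [xp = None] stands for
   +oo. *)
Definition place (xm : nat) (xp : option nat) (a : nat) : nat * bool :=
  if xp is Some r then
    if xm == r then (r, false)
    else if (xm < a)%N && (a < r)%N then (a, true)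
    else if (r < a)%N then (r, false)
    else (xm, false)
  else if (xm < a)%N then (a, true) else (xm, false).

(* [xms] lists the roots of the blocks containing b_j, b_(j+1), ... and [a]
   the labels a_j, a_(j+1), ... that remain to be inserted; [xp] is the root of
   the block containing a_(j-1). *)
Fixpoint nb_new_blocks (xp : option nat) (xms a : seq nat) : nat :=
  match xms, a with
  | xm :: xms', aj :: a' =>
      let: (r, new) := place xm xp aj in
      (new + nb_new_blocks (Some r) xms' a')%N
  | _, _ => 0%N
  end.

Definition bl n (s : labeling n) : nat :=
  (nb_bottom_blocks (bot_labels s)
   + nb_new_blocks None (bottom_roots (bot_labels s)) (top_labels s))%N.

(* Main.v *)
(* The root r_j of the block of a_j is the median of m_j = min(b_1, ..., b_j),
   a_j and r_(j-1), so (m_j, r_j) is a Markov chain, and bl counts the labels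
   that m or r newly takes as its value. Were the labels i.i.d. uniform on
   [0, 1], one column, weighted by t for each new value, would act on functions
   of (m, r) by an integral operator, and with
     D(x^k) = (t-1-k)/(k+1) x^(k+1),  h_0 = 1, h_(n+1) = h_n + D h_n,
     q_0 = 0, q_(n+1) = q_n + h_n  (so that D q_n = h_n - 1)
   the n-th iterate of 1 is h_n(m) h_n(r) - (D h_n)(m) q_n(r). Finite sets of
   labels give the same computation on Bernstein coefficients. At m = r = 1
   the value is C(n+t-1,n)^2 - C(n+t-1,n+1) C(n+t-1,n-1), which also counts the
   order-preserving maps into a chain of t elements, column by column. *)

Require Import Defs.
From mathcomp Require Import all_boot all_order all_algebra.
From mathcomp Require Import ring zify.
Import GRing.Theory Num.Theory.
Local Open Scope ring_scope.

(** * Falling factorials and binomial sums *)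

Lemma ffactnD n a b : (n ^_ (a + b) = n ^_ a * (n - a) ^_ b)%N.
Proof.
elim: b => [|b IH]; first by rewrite addn0 ffactn0 muln1.
by rewrite addnS !ffactnSr IH subnDA mulnA.
Qed.

Lemma ffactnSr_rat n b :
  (n ^_ b.+1)%:R = (n%:R - b%:R) * (n ^_ b)%:R :> rat.
Proof.
rewrite ffactnSr natrM mulrC; have [hb|hb] := leqP b n; first by rewrite natrB.
by rewrite ffact_small ?mulr0.
Qed.

Lemma sum_ffact b i s : (i <= s)%N ->
  \sum_(i <= k < s) (k ^_ b)%:R
  = ((s ^_ b.+1)%:R - (i ^_ b.+1)%:R) / b.+1%:R :> rat.
Proof.
elim: s => [|s IH].
  by rewrite leqn0 => /eqP->; rewrite big_geq // subrr mul0r.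
rewrite leq_eqVlt => /predU1P[->|his]; first by rewrite big_geq // subrr mul0r.
rewrite big_nat_recr //= IH // ffactSS natrM ffactnSr_rat -!natr1; field.
by rewrite natr1 pnatr_eq0.
Qed.

(** Vandermonde's identity with ['C(n, j)] read as ['C(n, n - j)]; its terms of index below [m]
    vanish. *)
Lemma Vandermonde_shift n l m :
  (\sum_(j < n.+1) 'C(n, j) * 'C(l, j + m) = 'C(n + l, n + m))%N.
Proof.
rewrite [(n + l)%N]addnC -binomial.Vandermonde.
rewrite -(big_mkord predT (fun j => 'C(l, j) * 'C(n, n + m - j))%N).
rewrite (big_cat_nat (n := m)) //=; last by lia.
rewrite [X in (X + _)%N]big1_seq ?add0n => [|j]; last first.
  by rewrite mem_index_iota => hj; rewrite (@bin_small n) ?muln0 //; lia.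
rewrite -{2}[m]add0n big_addn (_ : ((n + m).+1 - m = n.+1)%N); last by lia.
rewrite big_mkord; apply: eq_bigr => j _.
rewrite mulnC (_ : (n + m - (j + m) = n - j)%N); last by lia.
by rewrite bin_sub // -ltnS.
Qed.

Lemma leq_addS a b m n L :
  (a < m)%N -> (b < n)%N -> (m + n <= L.+2)%N -> (a + b <= L)%N.
Proof. lia. Qed.

(** * Bernstein coefficients of the transfer operator *)

Section Bernstein.
Variable tau : nat.
Let t : rat := tau.+1%:R.

(* With m = u, r = u + v and 1 = u + v + w, this is the coefficient of
   u^i v^(s-i) w^(L-s) / (i! (s-i)! (L-s)!) in m^a r^b = u^a (u+v)^b
   (u+v+w)^(L-a-b); meaningful only for a + b <= L and a <= i <= s <= L, or
   a > i, where it is 0. *)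
Definition bern_mono (L a b i s : nat) : rat :=
  (i ^_ a)%:R * ((s - a) ^_ b)%:R * ((L - a - b)`!)%:R.

(* In stepB and stepA, i and s stand for the numbers of labels below m and below
   r among the L.+1 labels available. *)
Definition stepB L (G : nat -> nat -> rat) i s : rat :=
  t * (\sum_(k < i) G k s.-1) + (s - i)%:R * G i s.-1 + (L.+1 - s)%:R * G i s.

Definition stepA L (G : nat -> nat -> rat) i s : rat :=
  i%:R * G i.-1 i.-1 + t * (\sum_(i <= k < s) G i k) + (L.+1 - s)%:R * G i s.

(** The coefficient [(t-1-k)/(k+1)] of [D(x^k)], with [t - 1 = tau]. *)
Definition raise_coef (k : nat) : rat := (tau%:R - k%:R) / k.+1%:R.

(** Coefficient form of [t * int_0^m x^a r^b dx + (1 - m) m^a r^b]: a label below [m] becomes the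
    new minimum with weight [t], any other leaves the state unchanged. *)
Lemma stepB_monomial L a b i s : (a + b <= L)%N -> (i <= s <= L.+1)%N ->
  stepB L (bern_mono L a b) i s
  = bern_mono L.+1 a b i s + raise_coef a * bern_mono L.+1 a.+1 b i s.
Proof.
move=> hab /andP[his hs].
rewrite /stepB /bern_mono subSS -!mulr_suml.
rewrite -(big_mkord predT (fun k => (k ^_ a)%:R)) sum_ffact // ffact0n subr0.
have [ha|ha] := ltnP i a.
  rewrite (@ffact_small i a) // (@ffact_small i a.+1); last by lia.
  by rewrite !(mul0r, mulr0, addr0).
have -> : (L.+1 - a - b = (L - a - b).+1)%N by lia.
have -> : (s - a.+1 = s.-1 - a)%N by lia.
have e : (s%:R - a%:R) * ((s.-1 - a) ^_ b)%:R
       = (s%:R - a%:R - b%:R) * ((s - a) ^_ b)%:R :> rat.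
  rewrite -natrB ?(leq_trans ha) // -ffactnSr_rat ffactnS natrM.
  by congr (_ * (_ ^_ _)%:R); lia.
rewrite factS natrM ffactnSr_rat.
have -> : (L - a - b).+1%:R = L%:R + 1 - a%:R - b%:R :> rat.
  have {2}-> : L = (L - a - b + a + b)%N by lia.
  by rewrite !natrD -natr1; ring.
rewrite !natrB // -[L.+1%:R]natr1 /raise_coef /t -[tau.+1%:R]natr1
  -[a.+1%:R]natr1.
have a1 : a%:R + 1 != 0 :> rat by rewrite natr1 pnatr_eq0.
apply: (mulfI a1).
set F := (_`!)%:R; set X := (i ^_ a)%:R.
set Y := ((s - a) ^_ b)%:R in e *; set Z := ((s.-1 - a) ^_ b)%:R in e *.
apply/eqP; rewrite -subr_eq0; apply/eqP.
(* Once the denominator is cleared, the sides differ by a multiple of [e], which equates two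
   expansions of [(s - a) ^_ b.+1]. *)
transitivity ((a%:R + 1) * X * F
  * ((s%:R - a%:R) * Z - (s%:R - a%:R - b%:R) * Y)).
  by field.
by rewrite e subrr mulr0.
Qed.

(** Coefficient form of [m^(a+b+1) + t m^a * int_m^r x^b dx + (1 - r) m^a r^b]: a label below [m]
    sends [r] to [m], one in between replaces [r] with weight [t]. The lower end of the integral and
    the first term merge into a power of [m] alone. *)
Lemma stepA_monomial L a b i s : (a + b <= L)%N -> (i <= s <= L.+1)%N ->
  stepA L (bern_mono L a b) i s
  = bern_mono L.+1 a b i s + raise_coef b * bern_mono L.+1 a b.+1 i s
    - raise_coef b * bern_mono L.+1 (a + b).+1 0 i s.
Proof.
move=> hab /andP[his hs].
have e0 : i%:R * ((i.-1 ^_ a)%:R * ((i.-1 - a) ^_ b)%:R)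
        = (i ^_ (a + b).+1)%:R :> rat.
  by rewrite ffactnS ffactnD !natrM.
rewrite /stepA /bern_mono -mulr_suml -mulr_sumr mulrA e0.
rewrite ffactn0 mulr1 subn0.
have -> : (L.+1 - (a + b).+1 = L - a - b)%N by lia.
have -> : (L.+1 - a - b.+1 = L - a - b)%N by lia.
have -> : (L.+1 - a - b = (L - a - b).+1)%N by lia.
have [ha|ha] := ltnP i a.
  rewrite (@ffact_small i a) // (@ffact_small i (a + b).+1); last by lia.
  by rewrite !(mul0r, mulr0, addr0, subr0).
have -> : \sum_(i <= k < s) ((k - a) ^_ b)%:R
    = \sum_(i - a <= k < s - a) (k ^_ b)%:R :> rat.
  rewrite -{1}(subnK ha) big_addn; apply: eq_bigr => k _.
  by rewrite addnK.
rewrite sum_ffact; last by lia.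
have -> : (i ^_ (a + b).+1 = i ^_ a * (i - a) ^_ b.+1)%N.
  by rewrite -addnS ffactnD.
rewrite natrM factS natrM (ffactnSr_rat (s - a)).
have -> : (L - a - b).+1%:R = L%:R + 1 - a%:R - b%:R :> rat.
  have {2}-> : L = (L - a - b + a + b)%N by lia.
  by rewrite !natrD -natr1; ring.
rewrite !natrB // ?(leq_trans ha) // -[L.+1%:R]natr1 /raise_coef /t.
rewrite -[tau.+1%:R]natr1 -[b.+1%:R]natr1.
have b1 : b%:R + 1 != 0 :> rat by rewrite natr1 pnatr_eq0.
by field.
Qed.

(** * Linear extension from monomials to polynomials *)

Definition lincomb (phi : nat -> rat) (p : {poly rat}) : rat :=
  \sum_(k < size p) p`_k * phi k.

Lemma lincomb_wide phi (p : {poly rat}) N :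
  (size p <= N)%N -> lincomb phi p = \sum_(k < N) p`_k * phi k.
Proof.
move=> hN; rewrite /lincomb (big_ord_widen _ (fun k => p`_k * phi k) hN).
rewrite big_mkcond /=.
apply: eq_bigr => k _; case: ltnP => // hk.
by rewrite nth_default // mul0r.
Qed.

Lemma lincombD phi : {morph lincomb phi : p q / p + q}.
Proof.
move=> p q; pose N := maxn (size p) (size q).
rewrite (@lincomb_wide phi (p + q) N) ?size_polyD //.
rewrite (@lincomb_wide phi p N) ?leq_maxl //
  (@lincomb_wide phi q N) ?leq_maxr //.
by rewrite -big_split; apply: eq_bigr => k _; rewrite coefD mulrDl.
Qed.

Lemma lincomb0 phi : lincomb phi 0 = 0.
Proof. by rewrite /lincomb size_poly0 big_ord0. Qed.

Lemma lincombN phi p : lincomb phi (- p) = - lincomb phi p.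
Proof. by apply/eqP; rewrite -addr_eq0 -lincombD addNr lincomb0. Qed.

Lemma lincombZX phi c k : lincomb phi (c *: 'X^k) = c * phi k.
Proof.
rewrite (@lincomb_wide _ _ k.+1); last first.
  by rewrite (leq_trans (size_scale_leq _ _)) // size_polyXn.
rewrite big_ord_recr /= big1 ?add0r => [|j _].
  by rewrite coefZ coefXn eqxx mulr1.
by rewrite coefZ coefXn ltn_eqF // mulr0 mul0r.
Qed.

Lemma lincomb_sum phi I (r : seq I) (F : I -> {poly rat}) :
  lincomb phi (\sum_(x <- r) F x) = \sum_(x <- r) lincomb phi (F x).
Proof. exact: (big_morph _ (lincombD phi) (lincomb0 phi)). Qed.

(* The operator D : p |-> t * int_0^x p - x * p; below, row_poly is h_n and
   skew_poly is q_n. *)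
Definition raise (p : {poly rat}) : {poly rat} :=
  \sum_(k < size p) (p`_k * raise_coef k) *: 'X^(k.+1).

Lemma coef_raise0 p : (raise p)`_0 = 0.
Proof.
by rewrite coef_sum big1 // => k _; rewrite coefZ coefXn mulr0.
Qed.

Lemma coef_raiseS p k : (raise p)`_k.+1 = p`_k * raise_coef k.
Proof.
rewrite coef_sum; have [hk|hk] := ltnP k (size p); last first.
  rewrite nth_default // mul0r big1 // => j _.
  by rewrite coefZ coefXn eqSS gtn_eqF ?mulr0 // (leq_trans _ hk).
rewrite (bigD1 (Ordinal hk)) //= coefZ coefXn eqxx mulr1 big1 ?addr0 // => j ne.
by rewrite coefZ coefXn eqSS eq_sym (negbTE (_ : (j : nat) != k)) ?mulr0.
Qed.

Lemma raiseD : {morph raise : p q / p + q}.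
Proof.
move=> p q; apply/polyP=> [[|k]]; rewrite coefD ?coef_raise0 ?addr0 //.
by rewrite !coef_raiseS coefD mulrDl.
Qed.

Lemma size_raise (p : {poly rat}) n : (size p <= n)%N ->
  (size (raise p) <= n.+1)%N.
Proof.
move=> hn; apply/leq_sizeP=> [[|k]] hk; first by [].
by rewrite coef_raiseS nth_default ?mul0r // (leq_trans hn).
Qed.

Lemma lincomb_raise phi (q : {poly rat}) : lincomb phi (raise q)
  = \sum_(k < size q) q`_k * raise_coef k * phi k.+1.
Proof. by rewrite lincomb_sum; apply: eq_bigr => k _; rewrite lincombZX. Qed.

Lemma lincomb_mul_raise phi (p q : {poly rat}) : lincomb phi (p * raise q) =
  \sum_(a < size p) \sum_(b < size q)
    p`_a * (q`_b * raise_coef b * phi (a + b).+1).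
Proof.
rewrite -{1}[p]coefK poly_def mulr_suml lincomb_sum; apply: eq_bigr => a _.
rewrite mulr_sumr lincomb_sum; apply: eq_bigr => b _.
by rewrite -scalerAl -scalerAr -exprD scalerA lincombZX addnS -!mulrA.
Qed.

(** Coefficients of [p(m) q(r)]. *)
Definition bern L (p q : {poly rat}) (i s : nat) : rat :=
  lincomb (fun a => lincomb (fun b => bern_mono L a b i s) q) p.

Lemma bernE L p q i s : bern L p q i s =
  \sum_(a < size p) \sum_(b < size q) p`_a * q`_b * bern_mono L a b i s.
Proof.
apply: eq_bigr => a _; rewrite mulr_sumr.
by apply: eq_bigr => b _; rewrite mulrA.
Qed.

Lemma bernDl L p1 p2 q i s :
  bern L (p1 + p2) q i s = bern L p1 q i s + bern L p2 q i s.
Proof. by rewrite /bern lincombD. Qed.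

Lemma bernNl L p q i s : bern L (- p) q i s = - bern L p q i s.
Proof. by rewrite /bern lincombN. Qed.

Lemma bernDr L p q1 q2 i s :
  bern L p (q1 + q2) i s = bern L p q1 i s + bern L p q2 i s.
Proof.
rewrite /bern {1}/lincomb; under eq_bigr => a _ do rewrite lincombD mulrDr.
exact: big_split.
Qed.

Lemma bernNr L p q i s : bern L p (- q) i s = - bern L p q i s.
Proof.
rewrite /bern {1}/lincomb; under eq_bigr => a _ do rewrite lincombN mulrN.
exact: sumrN.
Qed.

Lemma stepB_sum L I (r : seq I) (c : I -> rat) G i s :
  stepB L (fun i s => \sum_(x <- r) c x * G x i s) i s
  = \sum_(x <- r) c x * stepB L (G x) i s.
Proof.
rewrite /stepB exchange_big /= !mulr_sumr -!big_split /=; apply: eq_bigr => x _.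
by rewrite -mulr_sumr; ring.
Qed.

Lemma stepA_sum L I (r : seq I) (c : I -> rat) G i s :
  stepA L (fun i s => \sum_(x <- r) c x * G x i s) i s
  = \sum_(x <- r) c x * stepA L (G x) i s.
Proof.
rewrite /stepA exchange_big /= !mulr_sumr -!big_split /=; apply: eq_bigr => x _.
by rewrite -mulr_sumr; ring.
Qed.

Lemma eq_stepB L G G' i s : (i <= s <= L.+1)%N ->
  (forall j u, (j <= u <= L)%N -> G j u = G' j u) ->
  stepB L G i s = stepB L G' i s.
Proof.
move=> /andP[his hs] e; rewrite /stepB; congr (_ * _ + _ + _).
- by apply: eq_bigr => k _; apply: e; have := ltn_ord k; lia.
(* [G i s.-1] leaves the range only if [i = s], and [G i s] only if [s = L.+1]; their factors are
   then 0. *)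
- by have [->|ne] := eqVneq i s; rewrite ?subnn ?mul0r // e //; lia.
- by have [->|ne] := eqVneq s L.+1; rewrite ?subnn ?mul0r // e //; lia.
Qed.

Lemma stepB_bern L (p q : {poly rat}) i s : (size p + size q <= L.+2)%N ->
  (i <= s <= L.+1)%N ->
  stepB L (bern L p q) i s = bern L.+1 (p + raise p) q i s.
Proof.
move=> hpq his; rewrite bernDl bernE [X in _ = _ + X]/bern lincomb_raise.
transitivity (stepB L (fun i s => \sum_(a < size p) p`_a *
                (\sum_(b < size q) q`_b * bern_mono L a b i s)) i s).
  by [].
rewrite stepB_sum -big_split /=; apply: eq_bigr => a _.
rewrite stepB_sum -mulrA /lincomb !mulr_sumr -big_split /=.
apply: eq_bigr => b _.
rewrite stepB_monomial //; first by ring.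
exact: leq_addS (ltn_ord a) (ltn_ord b) hpq.
Qed.

Lemma stepA_bern L (p q : {poly rat}) i s : (size p + size q <= L.+2)%N ->
  (i <= s <= L.+1)%N ->
  stepA L (bern L p q) i s
  = bern L.+1 p (q + raise q) i s - bern L.+1 (p * raise q) 1 i s.
Proof.
move=> hpq his; rewrite bernDr bernE [X in _ = _ + X - _]/bern.
rewrite [X in _ = _ - X]/bern lincomb_mul_raise.
transitivity (stepA L (fun i s => \sum_(a < size p) p`_a *
                (\sum_(b < size q) q`_b * bern_mono L a b i s)) i s).
  by [].
rewrite stepA_sum {1}/lincomb -big_split -sumrB /=; apply: eq_bigr => a _.
rewrite stepA_sum lincomb_raise !mulr_sumr -big_split -sumrB /=.
apply: eq_bigr => b _.
rewrite stepA_monomial //; last exact: leq_addS (ltn_ord a) (ltn_ord b) hpq.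
by rewrite /lincomb size_poly1 big_ord1 coef1 /=; ring.
Qed.

(** * Iterates of the transfer operator *)

Fixpoint row_poly n : {poly rat} :=
  if n is m.+1 then row_poly m + raise (row_poly m) else 1.
Fixpoint skew_poly n : {poly rat} :=
  if n is m.+1 then skew_poly m + row_poly m else 0.

Lemma raise0 : raise 0 = 0.
Proof. by rewrite /raise size_poly0 big_ord0. Qed.

(** Telescoping: [q_n] is the sum of the [h_j] with [j < n], and [D h_j = h_(j+1) - h_j]. *)
Lemma raise_skew_poly n : raise (skew_poly n) = row_poly n - 1.
Proof.
elim: n => [|n IH] /=; first by rewrite raise0 subrr.
by rewrite raiseD IH; ring.
Qed.

Lemma size_row_poly n : (size (row_poly n) <= n.+1)%N.
Proof.
elim: n => [|n IH] /=; first by rewrite size_poly1.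
rewrite (leq_trans (size_polyD _ _)) // geq_max (leq_trans IH) //=.
exact: size_raise.
Qed.

Lemma size_skew_poly n : (size (skew_poly n) <= n)%N.
Proof.
elim: n => [|n IH] /=; first by rewrite size_poly0.
rewrite (leq_trans (size_polyD _ _)) // geq_max (leq_trans IH) //=.
exact: size_row_poly.
Qed.

(** Coefficients of [h_n(m) h_n(r) - (D h_n)(m) q_n(r)]; the degree is [n.*2] because each column
    uses two labels. *)
Definition weight_sum n (i s : nat) : rat :=
  bern n.*2 (row_poly n) (row_poly n) i s
  - bern n.*2 (raise (row_poly n)) (skew_poly n) i s.

(** The corrections in [m] alone are [- h_n D h_n] and [(D h_n)(D q_n)]. Since [D q_n = h_n - 1]
    they add up to [- D h_n], which cancels against the -1 in [q_n + D q_n = q_(n+1) - 1]. *)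
Lemma stepA_weight_sum n i s : (i <= s <= n.*2.+1)%N ->
  stepA n.*2 (weight_sum n) i s
  = bern n.*2.+1 (row_poly n) (row_poly n.+1) i s
    - bern n.*2.+1 (raise (row_poly n)) (skew_poly n.+1) i s.
Proof.
move=> his.
have -> : stepA n.*2 (weight_sum n) i s
  = stepA n.*2 (bern n.*2 (row_poly n) (row_poly n)) i s
    - stepA n.*2 (bern n.*2 (raise (row_poly n)) (skew_poly n)) i s.
  by rewrite /stepA /weight_sum !sumrB; ring.
have hh := leq_add (size_row_poly n) (size_row_poly n).
have hq := leq_add (size_raise _ _ (size_row_poly n)) (size_skew_poly n).
rewrite !stepA_bern ?(leq_trans hh) ?(leq_trans hq) //; try by lia.
rewrite raise_skew_poly mulrBr mulr1 !bernDr !bernNr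
  [row_poly n * _]mulrC bernDl bernNl.
by ring.
Qed.

(** The bottom label is read first, so its operator is the outer one; acting in [m], it turns [h_n]
    into [h_(n+1)] and [D h_n] into [D h_(n+1)]. *)
Lemma weight_sum_step n i s : (i <= s <= n.+1.*2)%N ->
  weight_sum n.+1 i s = stepB n.*2.+1 (stepA n.*2 (weight_sum n)) i s.
Proof.
move=> his; rewrite (eq_stepB _ _ _ _ _ his (stepA_weight_sum n)).
have -> : stepB n.*2.+1 (fun i s =>
      bern n.*2.+1 (row_poly n) (row_poly n.+1) i s
      - bern n.*2.+1 (raise (row_poly n)) (skew_poly n.+1) i s) i s
  = stepB n.*2.+1 (bern n.*2.+1 (row_poly n) (row_poly n.+1)) i s
    - stepB n.*2.+1 (bern n.*2.+1 (raise (row_poly n)) (skew_poly n.+1)) i s.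
  by rewrite /stepB !sumrB; ring.
have hh := leq_add (size_row_poly n) (size_row_poly n.+1).
have hq := leq_add (size_raise _ _ (size_row_poly n)) (size_skew_poly n.+1).
rewrite !stepB_bern ?(leq_trans hh) ?(leq_trans hq) //; try by lia.
by rewrite -raiseD.
Qed.

(** * Closed forms and values at 1 *)

Lemma mul_bin_raise_coef k : 'C(tau, k)%:R * raise_coef k = 'C(tau, k.+1)%:R.
Proof.
have k1 : k.+1%:R != 0 :> rat by rewrite pnatr_eq0.
have [hk|hk] := leqP k tau; last by rewrite !bin_small ?mul0r // ltnW.
apply: (mulfI k1); rewrite -natrM mul_bin_left natrM natrB // /raise_coef.
by rewrite mulrCA [k.+1%:R * _]mulrC divfK // mulrC.
Qed.

(** In the basis ['C(tau, k) x^k] the operator [D] is the shift of [k], so the recursion for [h_n]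
    is Pascal's rule. *)
Lemma coef_row_poly n k : (row_poly n)`_k = ('C(n, k) * 'C(tau, k))%:R.
Proof.
elim: n k => [|n IH] [|k] /=; rewrite ?coef1 ?bin0n ?bin0 ?coefD ?coef_raise0
  ?IH //.
  by rewrite !bin0 addr0.
rewrite coef_raiseS IH binS mulnDl natrD; congr (_ + _).
by rewrite natrM -mulrA mul_bin_raise_coef -natrM.
Qed.

Lemma coef_skew_poly n k : (skew_poly n)`_k = ('C(n, k.+1) * 'C(tau, k))%:R.
Proof.
elim: n => [|n IH] /=; first by rewrite coef0.
by rewrite coefD IH coef_row_poly -natrD -mulnDl binS.
Qed.

Lemma row_poly_at1 n : (row_poly n).[1] = 'C(n + tau, n)%:R.
Proof.
rewrite (horner_coef_wide _ (size_row_poly n)) -[X in 'C(_, X)]addn0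
  -Vandermonde_shift.
rewrite natr_sum; apply: eq_bigr => k _.
by rewrite expr1n mulr1 coef_row_poly addn0.
Qed.

Lemma raise_row_poly_at1 n : (raise (row_poly n)).[1] = 'C(n + tau, n.+1)%:R.
Proof.
rewrite (horner_coef_wide _ (size_raise _ _ (size_row_poly n))) big_ord_recl.
rewrite coef_raise0 mul0r add0r -[X in 'C(_, X)]addn1 -Vandermonde_shift.
rewrite natr_sum; apply: eq_bigr => k _.
rewrite expr1n mulr1 coef_raiseS coef_row_poly natrM.
by rewrite -mulrA mul_bin_raise_coef -natrM addn1.
Qed.

Lemma skew_poly_at1 n : (skew_poly n).[1] = 'C(n + tau, tau.+1)%:R.
Proof.
rewrite (@horner_coef_wide _ tau.+1); last first.
  by apply/leq_sizeP => k hk; rewrite coef_skew_poly (@bin_small tau) ?muln0.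
rewrite -[X in 'C(_, X)]addn1 [X in 'C(X, _)]addnC -Vandermonde_shift.
rewrite natr_sum; apply: eq_bigr => k _.
by rewrite expr1n mulr1 coef_skew_poly addn1 mulnC.
Qed.

(** This is the coefficient of [u^L / L!], hence [L!] times the value at [u = 1], [v = w = 0], where
    [m = r = 1]. *)
Lemma bern_diag L (p q : {poly rat}) : (size p + size q <= L.+2)%N ->
  bern L p q L L = L`!%:R * (p.[1] * q.[1]).
Proof.
move=> hpq; rewrite bernE !horner_coef mulr_suml mulr_sumr.
apply: eq_bigr => a _.
rewrite !mulr_sumr; apply: eq_bigr => b _.
rewrite !expr1n !mulr1 [RHS]mulrC; congr (_ * _).
have hab := leq_addS _ _ _ _ _ (ltn_ord a) (ltn_ord b) hpq.
by rewrite /bern_mono -!natrM -mulnA !ffact_fact //; lia.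
Qed.

Lemma weight_sum_diag n : weight_sum n n.*2 n.*2 = n.*2`!%:R *
  ('C(n + tau, n)%:R ^+ 2 - 'C(n + tau, n.+1)%:R * 'C(n + tau, tau.+1)%:R).
Proof.
have hh := leq_add (size_row_poly n) (size_row_poly n).
have hq := leq_add (size_raise _ _ (size_row_poly n)) (size_skew_poly n).
rewrite /weight_sum !bern_diag ?(leq_trans hh) ?(leq_trans hq) //; try by lia.
by rewrite row_poly_at1 raise_row_poly_at1 skew_poly_at1 -mulrBr.
Qed.

End Bernstein.

(** * Sums over words *)

Lemma count_lt_rem (x r : nat) A : x \in A ->
  count (fun y => y < r)%N (rem x A) = (count (fun y => y < r) A - (x < r))%N.
Proof. by move=> hx; rewrite count_rem hx. Qed.

(** After sorting, the rank of an element is its position. *)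
Lemma sum_ranks (F : nat -> rat) (B : seq nat) : uniq B ->
  \sum_(x <- B) F (count (fun y => y < x)%N B) = \sum_(i < size B) F i.
Proof.
move=> uB; have pB : perm_eq (sort leq B) B by rewrite perm_sort.
rewrite -(perm_big _ pB) -(perm_size pB) /=.
under eq_bigr => x _ do rewrite -(permP pB).
have : sorted ltn (sort leq B).
  by rewrite ltn_sorted_uniq_leq sort_uniq uB sort_sorted //; exact: leq_total.
elim: (sort leq B) F => [|x s IH] F /=; first by rewrite big_nil big_ord0.
move=> hs; have hx : all (fun y => x < y)%N s.
  by rewrite (path_sortedE (ltn_trans)) in hs; case/andP: hs.
rewrite big_cons big_ord_recl ltnn (_ : count _ s = 0%N); last first.
  apply/eqP; rewrite -leqn0 leqNgt -has_count -all_predC.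
  by apply: sub_all hx => y /= hy; lia.
congr (F _ + _); rewrite -(IH (fun i => F i.+1)); last exact: path_sorted hs.
by apply: eq_big_seq => y hy; rewrite (allP hx _ hy).
Qed.

(** For the sublist [B] of elements in [[m, r)], ranks in [A] are ranks in [B] shifted by the number
    [i] of elements below [m]. *)
Lemma sum_ranks_between (F : nat -> rat) (m r : nat) (A : seq nat) :
  uniq A -> (m <= r)%N ->
  \sum_(x <- A | (m <= x < r)%N) F (count (fun y => y < x)%N A)
  = \sum_(count (fun y => y < m)%N A <= i < count (fun y => y < r)%N A) F i.
Proof.
move=> uA mr; set i := count _ A; set s := count _ A.
pose B := [seq x <- A | (m <= x < r)%N].
have cA (x : nat) : (m <= x <= r)%N ->
    count (fun y => y < x)%N A = (count (fun y => y < x)%N B + i)%N.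
  move=> hx; rewrite count_filter -count_predUI /=.
  rewrite (@eq_count _ (predI _ _) pred0) => [|y] /=; last by lia.
  by rewrite count_pred0 addn0; apply: eq_count => y /=; lia.
rewrite -big_filter -/B big_seq_cond.
under eq_bigr => x /andP[hx _].
  rewrite cA; last by move: hx; rewrite mem_filter => /andP[/andP[-> /ltnW->]].
  over.
rewrite -big_seq_cond (sum_ranks (fun k => F (k + i)%N)) ?filter_uniq //.
have -> : s = (size B + i)%N.
  rewrite /s cA ?mr ?leqnn //; congr (_ + _)%N; apply/eqP.
  by rewrite -all_count; apply/allP=> x; rewrite mem_filter => /andP[/andP[]].
by rewrite -[RHS]/(\sum_(0 + i <= k < size B + i) F k) big_addn addnK big_mkord.
Qed.

(** * Summation over the next label *)

Section Steps.
Variable tau : nat.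
Let t : rat := tau.+1%:R.
Implicit Types (A : seq nat) (m r : nat) (G : nat -> nat -> rat).

Let below r A := count (fun y => y < r)%N A.

Lemma big_split3 A m r (F : nat -> rat) : (m <= r)%N ->
  \sum_(x <- A) F x = \sum_(x <- A | (x < m)%N) F x
    + \sum_(x <- A | (m <= x < r)%N) F x + \sum_(x <- A | (r <= x)%N) F x.
Proof.
move=> mr; rewrite (bigID (fun x => x < m)%N) /= -addrA; congr (_ + _).
rewrite (bigID (fun x => x < r)%N) /=; congr (_ + _); apply: eq_bigl => x; lia.
Qed.

Lemma sum_cond_const A (P : pred nat) (F : nat -> rat) c :
  {in A, forall x, P x -> F x = c} ->
  \sum_(x <- A | P x) F x = (count P A)%:R * c.
Proof.
move=> e; rewrite big_seq_cond (eq_bigr (fun=> c)) => [|x /andP[]].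
  2: exact: e.
by rewrite -big_seq_cond big_const_seq iter_addr_0 mulr_natl.
Qed.

Lemma count_split A m r : (m <= r)%N ->
  count (fun x => m <= x < r)%N A = (below r A - below m A)%N.
Proof.
move=> mr; apply/eqP; rewrite -(eqn_add2r (below m A)).
rewrite subnK; last by apply: sub_count => x /=; lia.
rewrite -count_predUI (@eq_count _ (predI _ _) pred0) => [|y] /=; last by lia.
by rewrite count_pred0 addn0; apply/eqP/eq_count => y /=; lia.
Qed.

Lemma count_above A r : count (fun x => r <= x)%N A = (size A - below r A)%N.
Proof.
rewrite -(count_predC (fun x => x < r)%N A) addKn.
by apply: eq_count => x /=; lia.
Qed.

(** The terms of [stepB] are the cases [b < m], [m <= b < r] and [r <= b]; removing [b] lowers the
    rank of [r] by one when [b < r]. *)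
Lemma sum_stepB L G A m r : uniq A -> size A = L.+1 -> (m <= r)%N ->
  \sum_(b <- A) t ^+ (b < m)%N
      * G (below (minn m b) (rem b A)) (below r (rem b A))
  = stepB tau L G (below m A) (below r A).
Proof.
move=> uA sA mr; rewrite (big_split3 A m r) // /stepB; congr (_ + _ + _).
- transitivity (\sum_(x <- A | (0 <= x < m)%N)
                  t * G (below x A) (below r A).-1).
    rewrite big_seq_cond [RHS]big_seq_cond.
    apply: eq_bigr => x /andP[hx xm]; rewrite xm expr1; congr (_ * G _ _).
      by rewrite /below count_lt_rem // (_ : minn m x = x) ?ltnn ?subn0 //; lia.
    by rewrite /below count_lt_rem // (leq_trans xm mr) subn1.
  rewrite -mulr_sumr; congr (_ * _).
  rewrite (sum_ranks_between (fun k => G k (below r A).-1)) //.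
  by rewrite (eq_count (a2 := pred0)) // count_pred0 big_mkord.
- rewrite -count_split //; apply: sum_cond_const => x hx /andP[mx xr].
  rewrite ltnNge mx expr0 mul1r; congr (G _ _).
    by rewrite (_ : minn m x = m) /below ?count_lt_rem //
      ?(ltnNge x) ?mx ?subn0 //; lia.
  by rewrite /below count_lt_rem // xr subn1.
- rewrite -sA -count_above; apply: sum_cond_const => x hx rx.
  rewrite ltnNge (leq_trans mr rx) expr0 mul1r; congr (G _ _).
    by rewrite (_ : minn m x = m) /below ?count_lt_rem //
      ?(ltnNge x) ?(leq_trans mr rx) ?subn0 //; lia.
  by rewrite /below count_lt_rem // ltnNge rx subn0.
Qed.

(** The same three cases for [a]; [m \notin A] makes the middle one strict, as a new block
    requires. *)
Lemma sum_stepA L G A m r : uniq A -> size A = L.+1 -> (m <= r)%N ->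
  m \notin A ->
  \sum_(a <- A) t ^+ (m < a < r)%N
      * G (below m (rem a A)) (below (maxn m (minn a r)) (rem a A))
  = stepA tau L G (below m A) (below r A).
Proof.
move=> uA sA mr mA; rewrite (big_split3 A m r) // /stepA; congr (_ + _ + _).
- apply: sum_cond_const => x hx xm.
  rewrite (_ : (m < x < r)%N = false) ?expr0 ?mul1r; last by lia.
  rewrite (_ : maxn m (minn x r) = m); last by lia.
  by rewrite /below count_lt_rem // xm subn1.
- rewrite mulr_sumr -(sum_ranks_between (fun k => t * G (below m A) k)) //.
  rewrite big_seq_cond [RHS]big_seq_cond.
  apply: eq_bigr => x /andP[hx /andP[mx xr]].
  have ne : m != x by apply: contraNneq mA => ->.
  rewrite (_ : (m < x < r)%N) ?expr1; last by lia.
  rewrite (_ : maxn m (minn x r) = x); last by lia.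
  by rewrite /below !count_lt_rem // ltnn ltnNge mx !subn0.
- rewrite -sA -count_above; apply: sum_cond_const => x hx rx.
  rewrite (_ : (m < x < r)%N = false) ?expr0 ?mul1r; last by lia.
  rewrite (_ : maxn m (minn x r) = r); last by lia.
  by rewrite /below !count_lt_rem // !ltnNge rx (leq_trans mr rx) !subn0.
Qed.

(* The word is b_1 a_1 b_2 a_2 ...; x_+ = +oo is encoded as any r larger than
   all the labels. *)
Fixpoint weight m r (w : seq nat) : nat :=
  if w is b :: a :: w' then
    let m' := minn m b in
    ((b < m) + (m' < a < r) + weight m' (maxn m' (minn a r)) w')%N
  else 0%N.

Lemma sum_permutationsS (F : seq nat -> rat) A : uniq A -> (0 < size A)%N ->
  \sum_(w <- permutations A) F w
  = \sum_(x <- A) \sum_(w <- permutations (rem x A)) F (x :: w).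
Proof.
move=> uA sA; rewrite (perm_big _ (permutationsE sA)) undup_id //.
by rewrite big_allpairs_dep.
Qed.

Lemma weight_sum0 : weight_sum tau 0 0 0 = 1.
Proof.
by rewrite (weight_sum_diag tau 0) add0n bin0 (@bin_small tau tau.+1) // fact0;
  ring.
Qed.

(** Both new values are among [m], [r], [a], [b], none of which remains; so the hypotheses of
    [sum_weight] survive a column. *)
Lemma clamp_notin A m r a b :
  uniq A -> b \in A -> a \in rem b A -> m \notin A -> r \notin A ->
  minn m b \notin rem a (rem b A)
  /\ maxn (minn m b) (minn a r) \notin rem a (rem b A).
Proof.
move=> uA hb ha mA rA; have ub := rem_uniq b uA.
have sub x : x \notin A -> x \notin rem a (rem b A).
  by apply: contra => /mem_rem/mem_rem.
have hbn : b \notin rem a (rem b A).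
  by apply/negP => /mem_rem; rewrite mem_rem_uniq // !inE eqxx.
have han : a \notin rem a (rem b A) by rewrite mem_rem_uniq // !inE eqxx.
have hm : minn m b \notin rem a (rem b A)
  by rewrite /minn; case: ifP => _; auto.
split=> //; rewrite /maxn; case: ifP => _ //.
by rewrite /minn; case: ifP => _; auto.
Qed.

(** Summing over the first two letters applies [stepA], then [stepB], to the sum over the remaining
    word, which depends on the labels left only through two ranks. *)
Lemma sum_weight n A m r : uniq A -> size A = n.*2 -> (m <= r)%N ->
  m \notin A -> r \notin A ->
  \sum_(w <- permutations A) t ^+ weight m r w
  = weight_sum tau n (below m A) (below r A).
Proof.
elim: n A m r => [|n IH] A m r uA sA mr mA rA.
  move/eqP: sA; rewrite size_eq0 => /eqP->.
  by rewrite big_seq1 expr0 weight_sum0.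
have hs : (below m A <= below r A <= n.+1.*2)%N.
  by rewrite -sA count_size andbT; apply: sub_count => x /=; lia.
rewrite weight_sum_step // -sum_stepB // sum_permutationsS ?sA //.
apply: eq_big_seq => b hb.
have ub := rem_uniq b uA; have sb := size_rem hb; rewrite sA /= in sb.
rewrite sum_permutationsS ?sb // -sum_stepA ?sb //; first last.
- rewrite /minn; case: ifP => _; last by rewrite mem_rem_uniq // !inE eqxx.
  by apply: contra mA; apply: mem_rem.
- by lia.
rewrite mulr_sumr; apply: eq_big_seq => a ha.
have ua := rem_uniq a ub; have sa := size_rem ha; rewrite sb /= in sa.
have [hm hr] := clamp_notin A m r a b uA hb ha mA rA.
rewrite -IH //; last by lia.
by rewrite !mulr_sumr; apply: eq_bigr => w _; rewrite mulrA -!exprD.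
Qed.
End Steps.

(** * Blocks counted by [weight] *)

Lemma leq_bottom_step m b : (bottom_step m b <= m)%N.
Proof. by rewrite /bottom_step; case: ltnP. Qed.

Lemma bottom_stepE m b : bottom_step m b = minn m b.
Proof. by rewrite /bottom_step /minn. Qed.

Lemma scanl_bottom_leq m bs : all (fun x => x <= m)%N (scanl bottom_step m bs).
Proof.
elim: bs m => [|b bs IH] m //=; rewrite leq_bottom_step /=.
by apply: sub_all (IH _) => x /leq_trans; apply; apply: leq_bottom_step.
Qed.

(** Running minima decrease weakly, so [m] recurs exactly when the next minimum is still [m]. *)
Lemma size_undup_scanl m b bs :
  size (undup (m :: scanl bottom_step m (b :: bs)))
  = ((b < m) + size (undup (bottom_step m b ::
    scanl bottom_step (bottom_step m b) bs)))%N.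
Proof.
rewrite [LHS]/=; case: ifP => hin.
  suff -> : (b < m)%N = false by [].
  apply: negbTE; apply/negP => hbm; move: hin.
  rewrite /bottom_step ltnNge (ltnW hbm) /= inE gtn_eqF //=.
  by move/(allP (scanl_bottom_leq b bs)); lia.
have hbm : (b <= m)%N.
  by rewrite leqNgt; apply/negP => hmb; rewrite /bottom_step hmb inE eqxx
    in hin.
have -> // : (b < m)%N.
rewrite ltn_neqAle hbm andbT; apply: contraFneq hin => <-.
by rewrite /bottom_step ltnn inE eqxx.
Qed.

Lemma nb_new_blocks_cons xp xm xms a s :
  nb_new_blocks xp (xm :: xms) (a :: s)
  = ((place xm xp a).2 + nb_new_blocks (Some (place xm xp a).1) xms s)%N.
Proof. by rewrite /=; case: place. Qed.

(** Ties being excluded, every placement case clamps [a] to [[m, r]], and the block is new when [a]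
    is interior. *)
Lemma place_clamp m r a : (m <= r)%N -> a != m -> a != r ->
  place m (Some r) a = (maxn m (minn a r), (m < a < r)%N).
Proof.
move=> mr am ar; rewrite /place; case: eqVneq => [->|ne].
  by congr (_, _); lia.
case: (boolP (m < a < r)%N) => [h|h]; first by congr (_, _); lia.
by case: ltnP => h'; congr (_, _); lia.
Qed.

(** Here [f] gives bottom labels and [g] top labels. The successor accounts for the starting value
    [m]: [undup] keeps it, while [weight] counts only changes. *)
Lemma weight_blocks (I : eqType) (f g : I -> nat) (js : seq I) m r :
  (m <= r)%N -> uniq (map g js) ->
  {in js, forall j, g j != m /\ g j != r} ->
  {in js &, forall j k, f j != g k} ->
  ((weight m r (flatten [seq [:: f j; g j] | j <- js])).+1
  = size (undup (m :: scanl bottom_step m (map f js)))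
    + nb_new_blocks (Some r) (scanl bottom_step m (map f js)) (map g js))%N.
Proof.
elim: js m r => [|j js IH] m r mr; first by [].
rewrite !map_cons => /= /andP[gj ug] gmr fg.
have hj : j \in j :: js by rewrite inE eqxx.
have sub k : k \in js -> k \in j :: js by rewrite inE orbC => ->.
have [gjm gjr] := gmr j hj.
have gjb : g j != minn m (f j).
  by rewrite /minn; case: ifP => // _; rewrite eq_sym fg.
have gne k : k \in js -> g k != g j.
  by move=> hk; apply: contraNneq gj => <-; apply: map_f.
have := size_undup_scanl m (f j) (map f js); rewrite [LHS]/= => ->.
rewrite bottom_stepE -[let: (_, _) := _ in _]/(nb_new_blocks (Some r)
  (minn m (f j) :: scanl bottom_step (minn m (f j)) (map f js)) (g j ::
    map g js)).
rewrite nb_new_blocks_cons place_clamp //=; last by lia.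
rewrite -!addnA -addnS; congr (_ + _)%N.
rewrite -addnS addnCA IH //.
- exact: leq_maxl.
- move=> k hk; have [gkm gkr] := gmr k (sub k hk).
  have gkf : g k != f j by rewrite eq_sym fg // sub.
  rewrite /maxn /minn; split; first by case: ifP.
  by do !case: ifP => _ //; apply: gne.
- by move=> k l hk hl; apply: fg; apply: sub.
Qed.

(** * Order-preserving maps *)

Section Chains.
Variable tau : nat.
Let T : finType := ('I_tau.+1 * 'I_tau.+1)%type.

(** A pair holds the values at the bottom and top cells of a column; [e] is the column to the right
    of [d]. *)
Definition shrink : rel T := fun d e =>
  [&& (e.1 <= d.1)%N, (e.2 <= d.2)%N & (e.1 <= e.2)%N].

Lemma shrink_trans : transitive shrink.
Proof.
move=> e d f /and3P[a1 a2 a3] /and3P[b1 b2 b3]; apply/and3P; split=> //.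
  exact: leq_trans b1 a1.
exact: leq_trans b2 a2.
Qed.

Definition nb_chains n (d : T) : nat :=
  #|[set p : n.-tuple T | path shrink d p]|.

Lemma nb_chains0 d : nb_chains 0 d = 1%N.
Proof.
rewrite /nb_chains -[RHS](card_tuple 0 T) cardsE; apply: eq_card => p.
by rewrite tuple0 !inE.
Qed.

Lemma nb_chainsS n d :
  nb_chains n.+1 d = (\sum_(e | shrink d e) nb_chains n e)%N.
Proof.
rewrite /nb_chains -sum1dep_card.
rewrite (reindex (fun ep : T * n.-tuple T => [tuple of ep.1 :: ep.2])) /=;
  last first.
  exists (fun p => (thead p, [tuple of behead p])) => [[e p] _|p _] /=.
    by congr (_, _); apply: val_inj.
  by rewrite -tuple_eta.
rewrite -(pair_big_dep (shrink d) (fun e (p : n.-tuple T) => path shrink e p)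
  (fun _ _ => 1%N)) /=.
by apply: eq_bigr => e _; rewrite sum1dep_card.
Qed.

Lemma sum_bin_row n m x : (n <= m)%N ->
  (\sum_(0 <= k < x) 'C(k + n, m) = 'C(x + n, m.+1))%N.
Proof.
move=> nm; elim: x => [|x IH]; first by rewrite big_geq // bin_small.
by rewrite big_nat_recr //= IH addSn binS.
Qed.

(** Hockey-stick summation along the other diagonal; the added 1 is the term [k = -1]. *)
Lemma sum_bin_diag n x :
  (\sum_(0 <= k < x) 'C(k + n, k.+1) + 1 = 'C(x + n, x))%N.
Proof.
elim: x => [|x IH]; first by rewrite big_geq // bin0.
by rewrite big_nat_recr //= addnAC IH addSn binS addnC.
Qed.

(** A determinant of Lindström-Gessel-Viennot shape, proved by summing over the first column. The
    factor ['C(d.2 + n, d.2.+1)] is ['C(d.2 + n, n - 1)] written so as to vanish at [n = 0]. *)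
Lemma nb_chainsE n (d : T) : (d.1 <= d.2)%N ->
  (nb_chains n d)%:R = 'C(d.1 + n, n)%:R * 'C(d.2 + n, n)%:R
                     - 'C(d.1 + n, n.+1)%:R * 'C(d.2 + n, d.2.+1)%:R :> rat.
Proof.
elim: n d => [|n IH] [x y] /= hxy.
  by rewrite nb_chains0 !addn0 !bin0 (@bin_small y) //; ring.
rewrite nb_chainsS natr_sum.
pose F (i j : nat) : rat := 'C(i + n, n)%:R * 'C(j + n, n)%:R
                     - 'C(i + n, n.+1)%:R * 'C(j + n, j.+1)%:R.
transitivity (\sum_(i < x.+1) \sum_(i <= j < y.+1) F i j).
  rewrite (eq_bigr (fun e : T => F e.1 e.2)) => [|e /and3P[_ _ /IH]] //.
  rewrite [RHS](big_ord_widen _ (fun i => \sum_(i <= j < y.+1) F i j)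
    (ltn_ord x)).
  rewrite -(pair_big_dep (fun i : 'I_tau.+1 => (i <= x)%N)
     (fun i j : 'I_tau.+1 => (j <= y)%N && (i <= j)%N) F) /=.
  apply: eq_bigr => i hi.
  rewrite -(big_mkord (fun j => (j <= y)%N && (i <= j)%N) (F i)).
  have hy : (y.+1 <= tau.+1)%N by exact: ltn_ord.
  rewrite [RHS](big_nat_widen _ _ tau.+1) // [RHS](big_nat_widenl _ 0%N) //.
(* The lower ends of the two hockey-stick sums contribute ['C(i + n, n) * 'C(i + n, n.+1)] with
   opposite signs. *)
have inner (i : nat) : (i <= y)%N -> \sum_(i <= j < y.+1) F i j
    = 'C(i + n, n)%:R * 'C(y + n.+1, n.+1)%:R
      - 'C(i + n, n.+1)%:R * 'C(y + n.+1, y.+1)%:R.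
  move=> hi; rewrite sumrB -!mulr_sumr.
  have e1 : \sum_(i <= j < y.+1) 'C(j + n, n)%:R
      = 'C(y + n.+1, n.+1)%:R - 'C(i + n, n.+1)%:R :> rat.
    rewrite addnS -addSn -!(@sum_bin_row n) //
      [X in _ = X%:R - _](big_cat_nat (n := i)) //=; last by lia.
    by rewrite natrD -!natr_sum; ring.
  have e2 : \sum_(i <= j < y.+1) 'C(j + n, j.+1)%:R
      = 'C(y + n.+1, y.+1)%:R - 'C(i + n, i)%:R :> rat.
    rewrite addnS -addSn -!sum_bin_diag
      [X in _ = (X + _)%:R - _](big_cat_nat (n := i)) //=; last by lia.
    by rewrite !natrD -!natr_sum; ring.
  rewrite e1 e2 (_ : 'C(i + n, i) = 'C(i + n, n)); first by ring.
  by rewrite -bin_sub ?leq_addr // addKn.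
rewrite (eq_bigr (fun i : 'I_x.+1 => 'C(i + n, n)%:R * 'C(y + n.+1, n.+1)%:R
      - 'C(i + n, n.+1)%:R * 'C(y + n.+1, y.+1)%:R)) => [|i _]; last first.
  by apply: inner; have := ltn_ord i; lia.
rewrite sumrB -!mulr_suml -!natr_sum.
rewrite -(big_mkord predT (fun i => 'C(i + n, n))).
rewrite -(big_mkord predT (fun i => 'C(i + n, n.+1))).
by rewrite !sum_bin_row // !addnS !addSn.
Qed.
End Chains.

(** * Order-preserving maps as chains of columns *)

Section Maps.
Variables n tau : nat.

Definition columns (f : {ffun rect n -> 'I_tau.+1}) :
  n.-tuple ('I_tau.+1 * 'I_tau.+1) :=
  [tuple (f (bot_cell j), f (top_cell j)) | j < n].

Lemma columns_bij : bijective columns.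
Proof.
exists (fun p => [ffun x : rect n => let d := tnth p x.2 in
                    if x.1 == ord0 then d.2 else d.1]).
  move=> f; apply/ffunP=> [[i j]]; rewrite ffunE tnth_mktuple /=.
  case: eqP => [->//|ne]; congr (f (_, j)); apply: val_inj.
  by case: i ne => [[|[|]]] //= hi [] ; apply: val_inj.
move=> p; apply: eq_from_tnth => j.
by rewrite tnth_mktuple !ffunE /= -surjective_pairing.
Qed.

(** Transitivity of [shrink] extends comparisons from adjacent columns to all; the starting pair
    only imposes trivial upper bounds. *)
Lemma order_preserving_path (f : {ffun rect n -> 'I_tau.+1}) :
  order_preserving f = path (@shrink tau) (ord_max, ord_max) (columns f).
Proof.
apply/idP/idP => [fo|].
  have mono x y : (x <= y)%O -> (f x <= f y)%N.
    by move: fo => /forallP/(_ x)/forallP/(_ y)/implyP.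
  apply/(pathP (ord_max, ord_max)) => i; rewrite size_tuple => hi.
  have E j (hj : (j < n)%N) : nth (ord_max, ord_max) (columns f) j
      = (f (bot_cell (Ordinal hj)), f (top_cell (Ordinal hj))).
    by rewrite -(tnth_nth _ _ (Ordinal hj)) tnth_mktuple.
  rewrite E /shrink /=.
  rewrite (mono (bot_cell _) (top_cell _)) ?rect_leE ?leqnn // andbT.
  case: i hi => [|i] hi /=; first by rewrite !leq_ord.
  by rewrite E ?(ltnW hi) // => h'; rewrite /= !mono ?rect_leE //=.
move=> hp; have hs := path_sorted hp.
apply/forallP => [[i k]]; apply/forallP=> [[i' j]]; apply/implyP.
rewrite rect_leE /= => /andP[hi hj].
have E (l : 'I_n) : nth (ord_max, ord_max) (columns f) l
    = (f (bot_cell l), f (top_cell l)).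
  by rewrite -tnth_nth tnth_mktuple.
have sz (l : 'I_n) : (l < size (columns f))%N by rewrite size_tuple.
have col l : (f (bot_cell l) <= f (top_cell l))%N.
  move: hp => /(pathP (ord_max, ord_max))/(_ l (sz l))/and3P[_ _].
  by rewrite E.
have rows (l l' : 'I_n) : (l' <= l)%N -> (f (bot_cell l) <= f (bot_cell l'))%N
                             && (f (top_cell l) <= f (top_cell l'))%N.
  rewrite leq_eqVlt => /predU1P[/val_inj->|ltl]; first by rewrite !leqnn.
  have := sorted_ltn_nth (@shrink_trans tau) (ord_max, ord_max) hs.
  by move/(_ l' l (sz l') (sz l) ltl); rewrite !E => /and3P[-> ->].
have /andP[r1 r2] := rows _ _ hj.
have row_cases (r : 'I_2) : r = ord0 \/ r = ord_max.
  by case: r => [[|[|]]] //= hr; [left|right]; apply: val_inj.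
case: (row_cases i) (row_cases i') hi => -> [] -> // _.
exact: leq_trans (col k) r2.
Qed.

Lemma card_order_preserving :
  #|[set f : {ffun rect n -> 'I_tau.+1} | order_preserving f]|
    = nb_chains tau n (ord_max, ord_max).
Proof.
rewrite /nb_chains -!sum1dep_card [RHS](reindex columns); last first.
  exact: onW_bij columns_bij.
by apply: eq_bigl => f; rewrite order_preserving_path.
Qed.
End Maps.

(** * Labelings *)

Section Words.
Variable n : nat.
Implicit Types s : labeling n.

Definition cells : seq (rect n) :=
  flatten [seq [:: bot_cell j; top_cell j] | j <- enum 'I_n].

Definition word s : seq nat :=
  flatten
    [seq [:: label s (bot_cell j); label s (top_cell j)] | j <- enum 'I_n].

Lemma wordE s : word s = map (label s) cells.
Proof.
by rewrite map_flatten -map_comp.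
Qed.

Lemma size_cells : size cells = (2 * n)%N.
Proof.
rewrite -{2}(size_enum_ord n) /cells.
by elim: (enum 'I_n) => [|j js /= ->]; rewrite ?mulnS.
Qed.

Lemma mem_cells x : x \in cells.
Proof.
apply/flatten_mapP; exists x.2; first by rewrite mem_enum.
case: x => [[[|[|]]] //= hi j]; rewrite !inE; apply/orP; [right|left];
by apply/eqP; congr (_, _); apply: val_inj.
Qed.

Lemma uniq_cells : uniq cells.
Proof.
apply: (leq_size_uniq (enum_uniq {: rect n})) => [x _|]; first exact: mem_cells.
by rewrite size_cells -cardE card_prod !card_ord.
Qed.

Lemma word_perm s : is_labeling s -> perm_eq (word s) (iota 1 (2 * n)).
Proof.
move=> /is_labelingP/bij_inj si; rewrite wordE.
have uw : uniq (map (label s) cells).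
  by rewrite map_inj_uniq ?uniq_cells // => x y [] /val_inj /si.
apply: uniq_perm; rewrite ?iota_uniq //.
refine (uniq_min_size uw _ _).2; last by rewrite size_map size_iota size_cells.
by move=> _ /mapP[x _ ->]; rewrite mem_iota /label /=; have := ltn_ord (s x);
  lia.
Qed.

Lemma word_inj : injective word.
Proof.
move=> s s'; rewrite !wordE => /eq_in_map e; apply/ffunP => x; apply: val_inj.
by case: (e x (mem_cells x)).
Qed.

(** [word] maps labelings injectively to permutations of [1, ..., 2n], and both sets have [(2n)!]
    elements. *)
Lemma sum_labelings (F : seq nat -> rat) :
  \sum_(s : labeling n | is_labeling s) F (word s)
  = \sum_(w <- permutations (iota 1 (2 * n))) F w.
Proof.
pose ws := map word (enum [set s : labeling n | is_labeling s]).
have uws : uniq ws by rewrite map_inj_uniq ?enum_uniq //; exact: word_inj.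
rewrite -(@perm_big _ _ _ _ ws); last first.
  apply: uniq_perm; rewrite ?permutations_uniq //.
  refine (uniq_min_size uws _ _).2.
    move=> _ /mapP[s + ->]; rewrite mem_enum inE mem_permutations.
    exact: word_perm.
  by rewrite size_map -cardE card_labelings size_permutations ?iota_uniq
    ?size_iota.
by rewrite big_map big_enum; apply: eq_bigl => s; rewrite inE.
Qed.

Lemma bottom_roots_scanl N bs : all (fun b => b < N)%N bs ->
  bottom_roots bs = scanl bottom_step N bs.
Proof.
case: bs => [|b bs] //= /andP[hb _].
by rewrite (_ : bottom_step N b = b) // /bottom_step ltnNge (ltnW hb).
Qed.

Lemma bottom_roots_lt N bs : all (fun b => b < N)%N bs ->
  all (fun b => b < N)%N (bottom_roots bs).
Proof.
case: bs => [|b bs] //= /andP[hb _]; rewrite hb.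
by apply: sub_all (scanl_bottom_leq b bs) => x /leq_ltn_trans; apply.
Qed.

(** The infinite root is consulted only for the first top label, where any [N] above all labels
    compares alike. *)
Lemma nb_new_blocks_None N xms a : all (fun x => x < N)%N xms ->
  all (fun x => x < N)%N a ->
  nb_new_blocks None xms a = nb_new_blocks (Some N) xms a.
Proof.
case: xms a => [|xm xms] [|x a] // /andP[hxm _] /andP[hx _].
rewrite !nb_new_blocks_cons (_ : place xm None x = place xm (Some N) x) //.
by rewrite /place ltn_eqF // hx andbT (ltnNge N) (ltnW hx).
Qed.

Lemma bl_weight s : is_labeling s ->
  bl s = weight (2 * n).+1 (2 * n).+1 (word s).
Proof.
move=> hs; set N := (2 * n).+1; have si : injective s.
  by apply: bij_inj; apply/is_labelingP.
have li : injective (label s) by move=> x y [] /val_inj /si.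
have ltN x : (label s x < N)%N by exact: ltn_ord.
have neN x : label s x != N by rewrite ltn_eqF.
pose f j := label s (bot_cell j); pose g j := label s (top_cell j).
have hw := @weight_blocks _ f g (enum 'I_n) N N (leqnn _).
have {hw} : ((weight N N (word s)).+1
  = size (undup (N :: scanl bottom_step N (bot_labels s)))
    + nb_new_blocks (Some N) (scanl bottom_step N (bot_labels s))
      (top_labels s))%N.
  apply: hw.
  - by rewrite map_inj_uniq ?enum_uniq // => j k /li [].
  - by move=> j _; split; apply: neN.
  - by move=> j k _ _; apply/eqP => /li.
have hb : all (fun b => b < N)%N (bot_labels s) by apply/allP=> _ /mapP[j _ ->].
have ha : all (fun b => b < N)%N (top_labels s) by apply/allP=> _ /mapP[j _ ->].
rewrite -(bottom_roots_scanl _ _ hb) /bl (nb_new_blocks_None N)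
  ?bottom_roots_lt //.
have hN : N \notin bottom_roots (bot_labels s).
  by apply/negP => /(allP (bottom_roots_lt N _ hb)); rewrite ltnn.
(* [N] is not a root, so it adds one distinct value, matching the successor in [weight_blocks]. *)
rewrite [undup (N :: _)]/= (negbTE hN) addSn.
by move=> [->].
Qed.

End Words.

Theorem theorem1p2 (n : nat) (hn : (1 <= n)%N) :
  ((2 * n)`!)%:R *: order_poly (rect n)
  = \sum_(s : labeling n | is_labeling s) 'X^(bl s) :> {poly rat}.
Proof.
have fact_neq0 : (2 * n)`!%:R != 0 :> rat by rewrite pnatr_eq0 -lt0n fact_gt0.
pose S : {poly rat} := \sum_(s : labeling n | is_labeling s) 'X^(bl s).
suff -> : order_poly (rect n) = (2 * n)`!%:R^-1 *: S.
  by rewrite scalerA divff // scale1r.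
(* It suffices to compare values at positive integers [t = tau.+1]. *)
apply: is_order_poly_unique (order_polyP (rect n)) _ => [[|tau]] // _.
rewrite card_order_preserving nb_chainsE // hornerZ horner_sum.
under eq_bigr => s hs do rewrite hornerXn bl_weight //.
rewrite (sum_labelings n (fun w => tau.+1%:R ^+ weight (2 * n).+1
  (2 * n).+1 w)).
have hN : (2 * n).+1 \notin iota 1 (2 * n) by rewrite mem_iota; lia.
have sz : size (iota 1 (2 * n)) = n.*2 by rewrite size_iota mul2n.
rewrite (sum_weight tau n _ _ _ (iota_uniq _ _) sz (leqnn _) hN hN) mul2n.
(* Every label is below the starting value, so both ranks are [n.*2], the diagonal case
   [m = r = 1]. *)
have -> : count (fun y => y < n.*2.+1)%N (iota 1 n.*2) = n.*2.
  rewrite -[RHS](size_iota 1 n.*2); apply/eqP; rewrite -all_count.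
  by apply/allP=> x; rewrite mem_iota; lia.
rewrite weight_sum_diag mulKf; last by rewrite -mul2n.
by rewrite expr2 addnC.
Qed.
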